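(* Consider the family of discrete-time load balancing systems described in the context, operated under a given Markovian load balancing policy, and assume $(\sigma_\Sigma^{(\epsilon)})^2 \to \sigma_\Sigma^2$ as $\epsilon\downarrow 0$. Suppose the policy is throughput optimal and that there exists $\alpha\in(0,1]$ such that the state space collapses to the cone $\mathcal{K}_\alpha$, i.e., there exist $\epsilon_0>0$ and constants $M_r$ ($r=1,2,\dots$) independent of $\epsilon$ such that $\mathbb{E}\big[\|\overline{\mathbf{Q}}^{(\epsilon)}_\perp\|^r\big]\le M_r$ for all $\epsilon\in(0,\epsilon_0)$ and all $r=1,2,\dots$. Then the policy is heavy-traffic delay optimal in steady state, i.e. $$\limsup_{\epsilon\downarrow 0}\ \epsilon\,\mathbb{E}\Big[\sum_{n=1}^N \overline{Q}_n^{(\epsilon)}\Big]\le \frac{\zeta}{2},\qquad \zeta=\sigma_\Sigma^2+\nu_\Sigma^2 .$$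
   Context: Model: a discrete-time system with one dispatcher and $N$ servers; server $n$ has an infinite-buffer FIFO queue of length $Q_n(t)$ at the beginning of slot $t$. The number of exogenous arrivals $A_\Sigma(t)$ at the beginning of slot $t$ is integer valued, i.i.d. over $t$, with mean $\lambda_\Sigma$, variance $\sigma_\Sigma^2$, $\mathbb{P}(A_\Sigma(t)=0)>0$ and $A_\Sigma(t)\le A_{\max}<\infty$. The service $S_n(t)$ offered by server $n$ in slot $t$ is integer valued, i.i.d. over $t$, independent across servers and of the arrivals, with $S_n(t)\le S_{\max}<\infty$, mean $\mu_n>0$ and variance $\nu_n^2$; $\mu_\Sigma=\sum_n\mu_n$, $\nu_\Sigma^2=\sum_n\nu_n^2$. In each slot the dispatcher sends the new arrivals to one queue according to a (possibly randomized) rule depending only on $\mathbf{Q}(t)$ (Markovian policy); $A_n(t)$ is the number routed to queue $n$. Dynamics: $Q_n(t+1)=Q_n(t)+A_n(t)-S_n(t)+U_n(t)$ with unused service $U_n(t)=\max\{S_n(t)-Q_n(t)-A_n(t),0\}$. Thus $\{\mathbf{Q}(t)\}$ is a Markov chain. One considers a family of such systems indexed by $\epsilon>0$, with the same service processes and arrival processes $A_\Sigma^{(\epsilon)}(t)$ of mean $\lambda_\Sigma^{(\epsilon)}=\mu_\Sigma-\epsilon$ and variance $(\sigma_\Sigma^{(\epsilon)})^2$. When the chain is positive recurrent, $\overline{\mathbf{Q}}^{(\epsilon)}$ denotes a random vector distributed according to its stationary distribution. A policy is throughput optimal if for every $\epsilon>0$ the chain is positive recurrent and all moments of $\|\overline{\mathbf{Q}}^{(\epsilon)}\|$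 are finite. Cone: for $\alpha\in[0,1]$, $\mathbf{b}^{(n)}\in\mathbb{R}^N$ has $n$-th component $1$ and all other components $\alpha$; $\mathcal{K}_\alpha=\{\sum_n w_n\mathbf{b}^{(n)}: w_n\ge 0\}$, and its polar cone is $\mathcal{K}_\alpha^\circ=\{\mathbf{x}:\langle \mathbf{x},\mathbf{y}\rangle\le 0\ \forall \mathbf{y}\in\mathcal{K}_\alpha\}$. Every $\mathbf{x}$ decomposes uniquely as $\mathbf{x}=\mathbf{x}_\parallel+\mathbf{x}_\perp$ with $\mathbf{x}_\parallel$ the Euclidean projection onto $\mathcal{K}_\alpha$ and $\mathbf{x}_\perp$ the projection onto $\mathcal{K}_\alpha^\circ$. $\|\cdot\|$ is the Euclidean norm. *)

(* Defs.v *)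
From HB Require Import structures.
From mathcomp Require Import all_boot all_order all_algebra.
From mathcomp Require Import all_classical all_reals.
From mathcomp Require Import ereal topology normedtype esum.
Set Implicit Arguments. Unset Strict Implicit. Unset Printing Implicit Defensive.
Import Order.TTheory GRing.Theory Num.Theory numFieldNormedType.Exports.
Local Open Scope ring_scope.
Local Open Scope classical_set_scope.

Section Defs.
Variable R : realType.

Definition pmf_bounded (p : nat -> R) (B : nat) : Prop :=
  (forall k, 0 <= p k) /\ (forall k, (B < k)%N -> p k = 0) /\
  \sum_(k < B.+1) p k = 1.

Definition pmf_mean (p : nat -> R) (B : nat) : R :=
  \sum_(k < B.+1) (k%:R * p k).

Definition pmf_var (p : nat -> R) (B : nat) : R :=
  \sum_(k < B.+1) ((k%:R - pmf_mean p B) ^+ 2 * p k).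

Variable N : nat.

Definition dotv (x y : 'rV[R]_N) : R := \sum_(i < N) x 0 i * y 0 i.
Definition normv (x : 'rV[R]_N) : R := Num.sqrt (dotv x x).

Definition bvec (alpha : R) (n : 'I_N) : 'rV[R]_N :=
  \row_(i < N) (if i == n then 1 else alpha).

Definition cone (alpha : R) : set 'rV[R]_N :=
  [set x | exists w : 'I_N -> R, (forall n, 0 <= w n) /\
           x = \sum_(n < N) w n *: bvec alpha n].

Definition polar (K : set 'rV[R]_N) : set 'rV[R]_N :=
  [set x | forall y, K y -> dotv x y <= 0].

Definition is_proj (C : set 'rV[R]_N) (x p : 'rV[R]_N) : Prop :=
  C p /\ forall y, C y -> normv (x - p) <= normv (x - y).

(* Euclidean projection onto C (chosen; it exists and is unique for
   nonempty closed convex C) *)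
Definition proj (C : set 'rV[R]_N) (x : 'rV[R]_N) : 'rV[R]_N :=
  xget 0 [set p | is_proj C x p].

Definition perp (alpha : R) (x : 'rV[R]_N) : 'rV[R]_N :=
  proj (polar (cone alpha)) x.

Definition state := {ffun 'I_N -> nat}.

Definition to_vec (q : state) : 'rV[R]_N := \row_(i < N) (q i)%:R.

(* Q_n(t+1) = Q_n + A_n - S_n + U_n = max(Q_n + A_n - S_n, 0) *)
Definition next (q : state) (a : nat) (n : 'I_N) (s : 'I_N -> nat) : state :=
  [ffun k => (q k + (if k == n then a else 0%N)) - s k]%N.

(* randomized Markovian routing policy: phi q n = P(route to n | Q = q) *)
Definition is_policy (phi : state -> 'I_N -> R) : Prop :=
  forall q, (forall n, 0 <= phi q n) /\ \sum_(n < N) phi q n = 1.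

Definition trans (Amax Smax : nat) (pA : nat -> R) (pS : 'I_N -> nat -> R)
  (phi : state -> 'I_N -> R) (q q' : state) : R :=
  \sum_(a < Amax.+1) \sum_(n < N) \sum_(s : {ffun 'I_N -> 'I_Smax.+1})
    pA a * phi q n * (\prod_(k < N) pS k (s k)) *
    (next q a n (fun k => nat_of_ord (s k)) == q')%:R.

Definition Exp (pi : state -> R) (f : state -> R) : \bar R :=
  \esum_(q in [set: state]) (pi q * f q)%:E.

Definition stationary (P : state -> state -> R) (pi : state -> R) : Prop :=
  (forall q, 0 <= pi q) /\
  (\esum_(q in [set: state]) (pi q)%:E = 1%E) /\
  (forall q', (pi q')%:E = \esum_(q in [set: state]) (pi q * P q q')%:E).

End Defs.

(* Main.v *)
Require Import Defs.
From HB Require Import structures.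
From mathcomp Require Import all_boot all_order all_algebra.
From mathcomp Require Import all_classical all_reals.
From mathcomp Require Import ereal topology normedtype esum.
From mathcomp Require Import derive ring lra zify.
Import Order.TTheory GRing.Theory Num.Theory numFieldNormedType.Exports.
Local Open Scope ring_scope.
Local Open Scope classical_set_scope.
Set Implicit Arguments. Unset Strict Implicit. Unset Printing Implicit Defensive.

(** In stationarity the drift of [(sum_n Q_n)^2] vanishes, which expresses
    [2 eps E(sum_n Q_n)] as the variance [E((A - S)^2)] plus the cross term
    [2 E(sum_m Q'_m sum_n U_n)], minus [E(U^2)], where [Q'] is the next state and
    [U_n] the unused service.  If [U_n > 0] then [Q'_n = 0]; since the vector
    [e_m - e_n / alpha] lies in the polar cone, the variational inequality of
    the projection [Q'_perp] then gives [Q'_m <= (1 + 1/alpha) |Q'_perp|].  As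
    [E(sum_n U_n) = eps] and [U] is bounded, Young's inequality and the bound on
    [E(|Q_perp|^2)] make the cross term arbitrarily small. *)

(** * Projection onto a polar cone *)

Section Geometry.
Variables (R : realType) (N : nat).
Implicit Types (x y z p : 'rV[R]_N) (C : set 'rV[R]_N).

Lemma dotvC x y : dotv x y = dotv y x.
Proof. by apply: eq_bigr => i _; rewrite mulrC. Qed.

Lemma dotvDl x y z : dotv (x + y) z = dotv x z + dotv y z.
Proof. by rewrite -big_split; apply: eq_bigr => i _; rewrite !mxE mulrDl. Qed.

Lemma dotvZl c x y : dotv (c *: x) y = c * dotv x y.
Proof. by rewrite big_distrr; apply: eq_bigr => i _; rewrite !mxE /= mulrA. Qed.

Lemma dotvBl x y z : dotv (x - y) z = dotv x z - dotv y z.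
Proof. by rewrite dotvDl -scaleN1r dotvZl mulN1r. Qed.

Lemma dotvv_ge0 x : 0 <= dotv x x.
Proof. by apply: sumr_ge0 => i _; rewrite -expr2 sqr_ge0. Qed.

Lemma normv_le_dotv x y : (normv x <= normv y) = (dotv x x <= dotv y y).
Proof. by rewrite ler_sqrt ?dotvv_ge0. Qed.

Lemma coord_le_normv x i : `|x 0 i| <= normv x.
Proof.
rewrite -sqrtr_sqr ler_wsqrtr // /dotv (bigD1 i) //= -expr2 lerDl.
by apply: sumr_ge0 => j _; rewrite -expr2 sqr_ge0.
Qed.

Lemma dotv_delta x i : dotv x (delta_mx 0 i) = x 0 i.
Proof.
rewrite /dotv (bigD1 i) //= mxE !eqxx mulr1 big1 ?addr0 // => j ji.
by rewrite mxE (negbTE ji) andbF mulr0.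
Qed.

Lemma continuous_dotv_sub x y : continuous (fun z => dotv (x - z) (y - z)).
Proof.
have cb w i : continuous (fun z : 'rV[R]_N => (w - z) 0 i).
  rewrite (_ : (fun _ => _) = (fun z : 'rV[R]_N => w 0 i - z 0 i)); last first.
    by apply/funext => z; rewrite !mxE.
  move=> z; apply: continuousB; first exact: cst_continuous.
  exact: coord_continuous.
rewrite /dotv; refine (continuous_big (add_continuous (s:=R)) _) => i _ z.
by apply: continuousM; exact: cb.
Qed.

Lemma continuous_dotvl y : continuous (fun z => dotv z y).
Proof.
rewrite /dotv; refine (continuous_big (add_continuous (s:=R)) _) => i _ z.
by apply: continuousM; [exact: coord_continuous | exact: cst_continuous].
Qed.

(** The squared distance to [x] is minimised over the part of [C] no farther from [x] than [c0].
    That part is closed and bounded, hence compact, and points of [C] outside it are farther than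
    [c0]. *)
Lemma is_proj_exists C x : closed C -> C !=set0 -> exists p, is_proj C x p.
Proof.
move=> clC [c0 Cc0].
pose r := dotv (x - c0) (x - c0).
pose f z := dotv (x - z) (x - z).
pose D := C `&` [set z | f z <= r].
have cf : continuous f by exact: continuous_dotv_sub.
have clD : closed D.
  apply: closedI => //.
  by apply: (@closed_comp _ _ f [set u | u <= r]) => // z _; exact: cf.
have bD : bounded_set D.
  exists (`|x| + Num.sqrt r); split; first exact: num_real.
  move=> M Mr z [_ /= fz]; apply/(le_trans _ (ltW Mr)).
  rewrite -[z](subrK x) addrC (le_trans (ler_normD _ _)) // lerD2l.
  rewrite -normrN opprB.
  (* The ambient norm on row vectors is the maximum norm, so the Euclidean bound is applied
     coordinate by coordinate. *)
  rewrite [leLHS]/Num.norm /= mx_normrE; apply: bigmax_le => [|[i j] _].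
    exact: sqrtr_ge0.
  by rewrite ord1 /= (le_trans (coord_le_normv _ _)) // ler_wsqrtr.
have [||p /set_mem[Cp _] pmin] :=
  @EVT_min_rV R N f D _ (bounded_closed_compact bD clD).
- by exists c0; split => //=.
- by apply: continuous_subspaceT.
exists p; split => // y Cy; rewrite normv_le_dotv.
have [fy|/ltW ry] := leP (f y) r.
  by apply: pmin; apply/mem_set.
apply: le_trans ry; rewrite -/(f p) -/(f c0).
by apply: pmin; apply/mem_set; split => //=.
Qed.

Lemma closed_polar C : closed (polar C).
Proof.
rewrite (_ : polar C = \bigcap_(y in C) [set x | dotv x y <= 0]); last first.
  by apply/seteqP; split => x xC y; exact: xC.
apply: closed_bigI => y _.
by apply: (@closed_comp _ _ (fun x => dotv x y) [set u | u <= 0]) => // z _;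
  exact: continuous_dotvl.
Qed.

Lemma polarD C x y t : 0 <= t -> polar C x -> polar C y -> polar C (x + t *: y).
Proof.
move=> t0 Cx Cy z Cz; rewrite dotvDl dotvZl.
by rewrite -[leRHS]addr0 lerD ?Cx // mulr_ge0_le0 ?Cy.
Qed.

(* Moving from the projection p along a direction y of the polar cone cannot decrease
   the distance to x; the first-order term gives the sign. *)
Lemma is_proj_polar_le0 C x p y :
  is_proj (polar C) x p -> polar C y -> dotv (x - p) y <= 0.
Proof.
move=> [Cp pmin] Cy; rewrite leNgt; apply/negP => d0.
set d := dotv (x - p) y in d0.
pose e := dotv y y; have e0 : 0 <= e by exact: dotvv_ge0.
(* This step length gives [t * e < d], so the squared distance drops by [t * (2 * d - t * e) > 0];
   the [+ 1] keeps the denominator positive when [y = 0]. *)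
pose t := d / (e + 1); have t0 : 0 < t by rewrite divr_gt0 // ltr_pwDr.
have := pmin _ (polarD (ltW t0) Cp Cy); rewrite normv_le_dotv.
have -> : dotv (x - (p + t *: y)) (x - (p + t *: y)) =
    dotv (x - p) (x - p) - t * (2 * d - t * e).
  have -> : x - (p + t *: y) = (x - p) - t *: y by rewrite opprD addrA.
  rewrite /e /d; move: (x - p) => u.
  rewrite dotvBl dotvZl ![dotv _ (u - _)]dotvC !dotvBl !dotvZl.
  by rewrite [dotv y u]dotvC; ring.
rewrite lerBrDl gerDr leNgt pmulr_rgt0 //.
have -> : t * e = d * (e / (e + 1)) by rewrite /t; ring.
have : e / (e + 1) < 1 by rewrite ltr_pdivrMr ?mul1r; lra.
by move=> h; rewrite subr_gt0 mulrC ltr_pM2r //; lra.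
Qed.

Lemma is_proj_perp alpha x :
  is_proj (polar (cone alpha)) x (perp alpha x).
Proof.
apply: (@xgetPex _ 0 [set p | is_proj (polar (cone alpha)) x p]).
apply: is_proj_exists; first exact: closed_polar.
by exists 0 => y _; rewrite /dotv big1 // => i _; rewrite mxE mul0r.
Qed.

(** Against each generator [bvec alpha k] the pairing is at most 0: its entry at [m] is at most 1,
    and its entry at [n] is at least [alpha]. *)
Lemma polar_cone_delta alpha (m n : 'I_N) : 0 < alpha <= 1 ->
  polar (cone alpha) (delta_mx 0 m - alpha^-1 *: delta_mx 0 n : 'rV[R]_N).
Proof.
move=> /andP[a0 a1] _ [w [w0 ->]].
rewrite dotvC [dotv _ (_ - _)]dotvC dotvBl dotvZl.
rewrite 2![dotv (delta_mx _ _) _]dotvC !dotv_delta subr_le0 !summxE.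
rewrite mulr_sumr; apply: ler_sum => k _; rewrite !mxE mulrCA ler_wpM2l //.
apply: (@le_trans _ _ 1); first by case: ifP.
rewrite -[leLHS](mulVf (lt0r_neq0 a0)) ler_wpM2l // ?invr_ge0 ?(ltW a0) //.
by case: ifP.
Qed.

(** Testing the variational inequality of the projection [p] against the vector of
    [polar_cone_delta] gives [x_m - x_n / alpha <= p_m - p_n / alpha], and [x_n] vanishes. *)
Lemma coord_le_perp alpha x (m n : 'I_N) : 0 < alpha <= 1 -> x 0 n = 0 ->
  x 0 m <= (1 + alpha^-1) * normv (perp alpha x).
Proof.
move=> ha xn0; set p := perp alpha x.
have := is_proj_polar_le0 (is_proj_perp alpha x) (polar_cone_delta m n ha).
rewrite dotvC dotvBl dotvZl ![dotv (delta_mx _ _) _]dotvC !dotv_delta.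
rewrite !mxE xn0 -/p sub0r => h.
have hm := le_trans (ler_norm _) (coord_le_normv p m).
have hn := le_trans (ler_norm _) (coord_le_normv (- p) n).
have : alpha^-1 * (- p 0 n) <= alpha^-1 * normv p.
  rewrite ler_wpM2l // ?invr_ge0; first by case/andP: ha => /ltW.
  by rewrite (le_trans _ (coord_le_normv _ n)) // -normrN ler_norm.
by rewrite mulrDl mul1r; lra.
Qed.

End Geometry.

(** * Expectations over the state space *)

Section Esum.
Local Open Scope ereal_scope.
Variables (R : realType).

(** Finite partial sums give one inequality for every nonnegative scalar; applied to [c^-1], it
    yields the converse when [c] is not 0. *)
Lemma esumZl (T : choiceType) (A : set T) (f : T -> \bar R) (c : R) :
  (0 <= c)%R -> (forall i, 0 <= f i) ->
  \esum_(i in A) (c%:E * f i) = c%:E * \esum_(i in A) f i.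
Proof.
have half (d : R) g : (0 <= d)%R -> (forall i, 0 <= g i) ->
    \esum_(i in A) (d%:E * g i) <= d%:E * \esum_(i in A) g i.
  move=> d0 g0; apply: ge_ereal_sup => _ [X [finX XA] <-].
  rewrite fsbig_finite //= -ge0_sume_distrr //.
  apply: lee_wpmul2l => //; rewrite -fsbig_finite //=.
  by apply: esum_ge; exists X.
move=> c0 f0; apply/eqP; rewrite eq_le half //=.
have [->|cn0] := eqVneq c 0%R.
  by rewrite mul0e esum_ge0 // => i _; rewrite mul0e.
have cp : (0 < c)%R by rewrite lt_def cn0.
rewrite -lee_pdivlMl //.
have -> : \esum_(i in A) f i = \esum_(i in A) ((c^-1)%:E * (c%:E * f i)).
  by apply: eq_esum => i _; rewrite muleA -EFinM mulVf // mul1e.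
by apply: half; rewrite ?invr_ge0 // => i; rewrite mule_ge0 ?f0.
Qed.

Lemma esum_swap (T U : choiceType) (a : T -> U -> \bar R) :
  (forall i j, 0 <= a i j) ->
  \esum_(i in [set: T]) \esum_(j in [set: U]) a i j =
  \esum_(j in [set: U]) \esum_(i in [set: T]) a i j.
Proof.
move=> a0; rewrite !esum_esum //.
rewrite (reindex_esum [set: U * T] _ (fun x => (x.2, x.1))) //; last first.
  split=> //=; first by move=> [i1 i2] [j1 j2] /= _ _ [-> ->].
  by move=> [i j] _; exists (j, i).
by rewrite (_ : _ `*`` _ = setT) //; apply/seteqP; split.
Qed.

Lemma esum_point (T : choiceType) (x : T) (f : T -> \bar R) : 0 <= f x ->
  \esum_(y in [set: T]) (if x == y then f y else 0) = f x.
Proof.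
move=> fx0; rewrite -(esum_set1 fx0) [RHS]esum_mkcond; apply: eq_esum => y _.
by case: eqP => [->|xy]; [rewrite mem_set | rewrite memNset // => yx; case: xy].
Qed.

End Esum.

Section Expectation.
Variables (R : realType) (N : nat) (pi : state N -> R).
Hypothesis pi_ge0 : forall q, 0 <= pi q.
Implicit Types f g : state N -> R.

Lemma Exp_ge0 f : (forall q, 0 <= f q) -> (0 <= Exp pi f)%E.
Proof. by move=> f0; apply: esum_ge0 => q _; rewrite lee_fin mulr_ge0. Qed.

Lemma le_Exp f g : (forall q, f q <= g q) -> (Exp pi f <= Exp pi g)%E.
Proof. by move=> fg; apply: le_esum => q _; rewrite lee_fin ler_wpM2l. Qed.

Lemma ExpD f g : (forall q, 0 <= f q) -> (forall q, 0 <= g q) ->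
  Exp pi (fun q => f q + g q) = (Exp pi f + Exp pi g)%E.
Proof.
move=> f0 g0; rewrite /Exp -esumD => [|q _|q _]; try by rewrite lee_fin mulr_ge0.
by apply: eq_esum => q _; rewrite mulrDr.
Qed.

Lemma ExpZ c f : 0 <= c -> (forall q, 0 <= f q) ->
  Exp pi (fun q => c * f q) = (c%:E * Exp pi f)%E.
Proof.
move=> c0 f0; rewrite /Exp -esumZl // => [|q]; last by rewrite lee_fin mulr_ge0.
by apply: eq_esum => q _; rewrite -EFinM mulrCA.
Qed.

Lemma Exp_cst c : 0 <= c -> \esum_(q in [set: state N]) (pi q)%:E = 1%E ->
  Exp pi (fun=> c) = c%:E.
Proof.
move=> c0 pi1; rewrite /Exp.
under eq_esum do rewrite mulrC EFinM.
by rewrite esumZl // ?pi1 ?mule1 // => q; rewrite lee_fin.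
Qed.

End Expectation.

(** * One step of the chain *)

Section Pmf.
Variables (R : realType) (p : nat -> R) (B : nat).
Hypothesis hp : pmf_bounded p B.

Lemma pmf_centered : \sum_(k < B.+1) p k * (k%:R - pmf_mean p B) = 0.
Proof.
case: hp => _ [_ p1].
under eq_bigr do rewrite mulrBr.
rewrite sumrB -mulr_suml p1 mul1r /pmf_mean.
by under eq_bigr do rewrite mulrC; rewrite subrr.
Qed.

Lemma pmf_var_ge0 : 0 <= pmf_var p B.
Proof. by case: hp => p0 _; apply: sumr_ge0 => k _; rewrite mulr_ge0 // sqr_ge0. Qed.

End Pmf.

(** * Expectations under the product law of the services *)

Section Service.
Variables (R : realType) (N Smax : nat) (pS : 'I_N -> nat -> R).
Hypothesis hpS : forall n, pmf_bounded (pS n) Smax.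

Definition service_exp (g : {ffun 'I_N -> 'I_Smax.+1} -> R) : R :=
  \sum_(s : {ffun 'I_N -> 'I_Smax.+1}) (\prod_(k < N) pS k (s k)) * g s.

(** Independence across servers, obtained by distributing the product over the sums. *)
Lemma service_exp_prod (h : 'I_N -> nat -> R) :
  service_exp (fun s => \prod_k h k (s k)) =
  \prod_k \sum_(j < Smax.+1) pS k j * h k j.
Proof.
rewrite bigA_distr_bigA; apply: eq_bigr => s _.
by rewrite -big_split.
Qed.

Lemma service_exp_sum (I : finType) (g : I -> {ffun 'I_N -> 'I_Smax.+1} -> R) :
  service_exp (fun s => \sum_i g i s) = \sum_i service_exp (g i).
Proof. by rewrite exchange_big; apply: eq_bigr => s _; rewrite mulr_sumr. Qed.

Let pS1 k : \sum_(j < Smax.+1) pS k j * 1 = 1.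
Proof. by under eq_bigr do rewrite mulr1; case: (hpS k) => _ []. Qed.

Lemma service_exp_coord k (h : nat -> R) :
  service_exp (fun s => h (s k)) = \sum_(j < Smax.+1) pS k j * h j.
Proof.
pose H i x := if i == k then h x else 1.
transitivity (service_exp (fun s => \prod_i H i (s i))).
  apply: eq_bigr => s _; congr (_ * _).
  by rewrite /H -big_mkcond big_pred1_eq.
rewrite service_exp_prod (bigD1 k) //= /H eqxx [X in _ * X]big1 ?mulr1 // => i ik.
by rewrite (negbTE ik).
Qed.

Lemma service_exp1 : service_exp (fun=> 1) = 1.
Proof.
transitivity (service_exp (fun s => \prod_(k < N) 1)).
  by apply: eq_bigr => s _; rewrite big1_eq.
by rewrite (service_exp_prod (fun _ _ => 1)) big1.
Qed.

Lemma service_exp_coord2 k l (h g : nat -> R) : k != l ->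
  service_exp (fun s => h (s k) * g (s l)) =
  (\sum_(j < Smax.+1) pS k j * h j) * (\sum_(j < Smax.+1) pS l j * g j).
Proof.
move=> kl.
pose H i x := if i == k then h x else if i == l then g x else 1.
transitivity (service_exp (fun s => \prod_i H i (s i))).
  apply: eq_bigr => s _; congr (_ * _).
  rewrite (bigD1 k) //= (bigD1 l) 1?eq_sym //= big1 => [|i /andP[ik il]].
    by rewrite /H eqxx eq_sym (negbTE kl) eqxx mulr1.
  by rewrite /H (negbTE ik) (negbTE il).
rewrite service_exp_prod (bigD1 k) //= (bigD1 l) 1?eq_sym //=.
rewrite [X in _ * (_ * X)]big1.
  by rewrite /H eqxx eq_sym (negbTE kl) eqxx mulr1.
by move=> i /andP[ik il]; rewrite /H (negbTE ik) (negbTE il).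
Qed.

(** Variances of independent terms add: each off-diagonal product factors into two zero means. *)
Lemma service_exp_sqr_sum (h : 'I_N -> nat -> R) :
  (forall k, \sum_(j < Smax.+1) pS k j * h k j = 0) ->
  service_exp (fun s => (\sum_k h k (s k)) ^+ 2) =
  \sum_k \sum_(j < Smax.+1) pS k j * h k j ^+ 2.
Proof.
move=> h0.
transitivity (service_exp (fun s => \sum_k \sum_l h k (s k) * h l (s l))).
  apply: eq_bigr => s _; congr (_ * _); rewrite expr2 mulr_suml.
  by apply: eq_bigr => k _; rewrite mulr_sumr.
rewrite service_exp_sum; apply: eq_bigr => k _.
rewrite service_exp_sum (bigD1 k) //= [X in _ + X]big1 ?addr0 => [|l lk].
  by rewrite (service_exp_coord k (fun x => h k x * h k x)).
by rewrite service_exp_coord2 1?eq_sym // h0 mul0r.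
Qed.

End Service.

Section OneStep.
Variables (R : realType) (N Amax Smax : nat).
Variables (pA : nat -> R) (pS : 'I_N -> nat -> R) (phi : state N -> 'I_N -> R).
Hypothesis hpA : pmf_bounded pA Amax.
Hypothesis hpS : forall n, pmf_bounded (pS n) Smax.
Hypothesis hphi : is_policy phi.

(** Arrivals, chosen queue and services of one slot, packed into one finite type so that the triple
    sum in [trans] becomes a single sum. *)
Definition outcome : finType :=
  ('I_Amax.+1 * 'I_N * {ffun 'I_N -> 'I_Smax.+1})%type.

Definition weight (q : state N) (o : outcome) : R :=
  pA o.1.1 * phi q o.1.2 * \prod_(k < N) pS k (o.2 k).

Definition next_state (q : state N) (o : outcome) : state N :=
  Defs.next q o.1.1 o.1.2 (fun k => nat_of_ord (o.2 k)).

Definition step_exp (q : state N) (g : outcome -> R) : R :=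
  \sum_o weight q o * g o.

Lemma weight_ge0 q o : 0 <= weight q o.
Proof.
have [pA0 _] := hpA; have [phi0 _] := hphi q.
by rewrite !mulr_ge0 // prodr_ge0 // => k _; have [] := hpS k.
Qed.

Lemma trans_step_exp q q' :
  trans Amax Smax pA pS phi q q' = step_exp q (fun o => (next_state q o == q')%:R).
Proof. by rewrite /trans !pair_bigA. Qed.

Lemma step_exp_ge0 q g : (forall o, 0 <= g o) -> 0 <= step_exp q g.
Proof. by move=> g0; apply: sumr_ge0 => o _; rewrite mulr_ge0 ?weight_ge0. Qed.

Lemma le_step_exp q g h : (forall o, g o <= h o) -> step_exp q g <= step_exp q h.
Proof. by move=> gh; apply: ler_sum => o _; rewrite ler_wpM2l ?weight_ge0. Qed.

Lemma step_expD q g h :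
  step_exp q (fun o => g o + h o) = step_exp q g + step_exp q h.
Proof. by rewrite -big_split; apply: eq_bigr => o _; rewrite mulrDr. Qed.

Lemma step_expZ q c g : step_exp q (fun o => c * g o) = c * step_exp q g.
Proof. by rewrite mulr_sumr; apply: eq_bigr => o _; rewrite mulrCA. Qed.

(** Neither factor sees the chosen queue, so the routing probabilities sum out to 1 and the policy
    disappears. *)
Lemma step_exp_indep q (h : nat -> R) g :
  step_exp q (fun o => h o.1.1 * g o.2) =
  (\sum_(a < Amax.+1) pA a * h a) * service_exp pS g.
Proof.
have [_ phi1] := hphi q.
rewrite mulr_suml /step_exp.
rewrite -(pair_bigA _ (fun an s => weight q (an, s) * (h an.1 * g s))) /=.
rewrite -(pair_bigA _ (fun a n => \sum_s weight q (a, n, s) * (h a * g s))) /=.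
apply: eq_bigr => a _.
rewrite -[RHS]mul1r -phi1 mulr_suml; apply: eq_bigr => n _.
rewrite /service_exp !mulr_sumr; apply: eq_bigr => s _.
by rewrite /weight /=; ring.
Qed.

Lemma step_exp_arrival q (h : nat -> R) :
  step_exp q (fun o => h o.1.1) = \sum_(a < Amax.+1) pA a * h a.
Proof.
transitivity (step_exp q (fun o => h o.1.1 * 1)).
  by apply: eq_bigr => o _; rewrite mulr1.
by rewrite (step_exp_indep q h (fun=> 1)) service_exp1 ?mulr1.
Qed.

Lemma step_exp_service q g : step_exp q (fun o => g o.2) = service_exp pS g.
Proof.
transitivity (step_exp q (fun o => 1 * g o.2)).
  by apply: eq_bigr => o _; rewrite mul1r.
rewrite (step_exp_indep q (fun=> 1)); under eq_bigr do rewrite mulr1.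
by have [_ [_ ->]] := hpA; rewrite mul1r.
Qed.

Lemma step_exp_cst q c : step_exp q (fun=> c) = c.
Proof.
rewrite (step_exp_arrival q (fun=> c)) -mulr_suml.
by have [_ [_ ->]] := hpA; rewrite mul1r.
Qed.

Let lambda := pmf_mean pA Amax.
Let mu := \sum_(n < N) pmf_mean (pS n) Smax.

Lemma step_exp_arrival_mean q : step_exp q (fun o => (o.1.1)%:R) = lambda.
Proof.
rewrite (step_exp_arrival q (fun a => a%:R)).
by apply: eq_bigr => a _; rewrite mulrC.
Qed.

Lemma step_exp_service_mean q :
  step_exp q (fun o => \sum_k (o.2 k)%:R) = mu.
Proof.
rewrite (step_exp_service q (fun s => \sum_k (s k)%:R)) service_exp_sum.
apply: eq_bigr => k _; rewrite (service_exp_coord hpS k (fun x => x%:R)).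
by apply: eq_bigr => a _; rewrite mulrC.
Qed.

Lemma step_exp_sqr_net q :
  step_exp q (fun o => ((o.1.1)%:R - \sum_k (o.2 k)%:R) ^+ 2) =
  pmf_var pA Amax + \sum_n pmf_var (pS n) Smax + (lambda - mu) ^+ 2.
Proof.
pose d (a : nat) := a%:R - lambda.
pose G (s : {ffun 'I_N -> 'I_Smax.+1}) :=
  \sum_k ((s k)%:R - pmf_mean (pS k) Smax).
have d0 : \sum_(a < Amax.+1) pA a * d a = 0 by exact: pmf_centered.
have G0 : service_exp pS G = 0.
  rewrite service_exp_sum big1 // => k _.
  rewrite (service_exp_coord hpS k (fun x => x%:R - pmf_mean (pS k) Smax)).
  exact: pmf_centered.
have GE s : G s = \sum_k (s k)%:R - mu by rewrite /G sumrB.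
(* Expansion of the square of [d - G + (lambda - mu)]; every term linear in [d] or [G], and the
   product [d * G], has mean 0. *)
transitivity (step_exp q (fun o => d o.1.1 ^+ 2 + (G o.2 ^+ 2 +
    ((lambda - mu) ^+ 2 + ((-2) * (d o.1.1 * G o.2) +
     (2 * (lambda - mu) * d o.1.1 + (-2) * (lambda - mu) * G o.2)))))).
  by apply: eq_bigr => o _; rewrite GE /d; congr (_ * _); ring.
rewrite 5!step_expD step_exp_cst 3!step_expZ step_exp_indep.
rewrite (step_exp_arrival q d) (step_exp_arrival q (fun a => d a ^+ 2)) d0.
rewrite (step_exp_service q G) (step_exp_service q (fun s => G s ^+ 2)) G0.
rewrite (service_exp_sqr_sum hpS (h := fun k x => x%:R - pmf_mean (pS k) Smax)).
  rewrite mul0r !mulr0 !addr0 addrA; congr (_ + _ + _).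
    by apply: eq_bigr => a _; rewrite mulrC.
  by apply: eq_bigr => k _; apply: eq_bigr => a _; rewrite mulrC.
by move=> k; exact: pmf_centered.
Qed.

(** Invariance of [pi] tested against [f], by exchanging the two sums over states. It is an identity
    in the extended reals, so no integrability of [f] has to be known beforehand. *)
Lemma Exp_step pi f : stationary (trans Amax Smax pA pS phi) pi ->
  (forall q, 0 <= f q) ->
  Exp pi (fun q => step_exp q (fun o => f (next_state q o))) = Exp pi f.
Proof.
move=> [pi0 [_ piP]] f0; rewrite /Exp; apply/esym.
have P0 q q' : 0 <= trans Amax Smax pA pS phi q q'.
  by rewrite trans_step_exp step_exp_ge0.
have pw0 q o : 0 <= pi q * weight q o.
  by apply: mulr_ge0 => //; exact: weight_ge0.
transitivity (\esum_(q' in [set: state N]) \esum_(q in [set: state N])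
    (f q' * (pi q * trans Amax Smax pA pS phi q q'))%:E)%E.
  apply: eq_esum => q' _; rewrite mulrC EFinM piP -esumZl //.
  by move=> q; rewrite lee_fin mulr_ge0.
rewrite esum_swap => [|q' q]; last by rewrite lee_fin !mulr_ge0.
apply: eq_esum => q _.
(* Each outcome leads to exactly one state, so once the finite sum is pulled out the sum over [q']
   reduces to a single term. *)
transitivity (\esum_(q' in [set: state N]) \sum_o
    ((pi q * weight q o)%:E *
       if next_state q o == q' then (f q')%:E else 0))%E.
  apply: eq_esum => q' _; rewrite trans_step_exp /step_exp !mulr_sumr -sumEFin.
  apply: eq_bigr => o _; case: eqP => _; rewrite ?mule0 ?mulr0 // -EFinM.
  by rewrite mulr1 mulrC.
rewrite esum_sum => [|q' o _ _]; last first.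
  by rewrite mule_ge0 ?lee_fin ?pw0 //; case: ifP; rewrite ?lee_fin.
rewrite /step_exp mulr_sumr -sumEFin; apply: eq_bigr => o _.
rewrite esumZl ?pw0 // => [|q']; last by case: ifP; rewrite ?lee_fin.
rewrite (esum_point (f := fun q' => (f q')%:E)) ?lee_fin //.
by rewrite -EFinM mulrA.
Qed.

End OneStep.

(** * Drift of the total queue length *)

Lemma sumr_ord_const (R : pzSemiRingType) (n : nat) (x : R) :
  \sum_(i < n) x = n%:R * x.
Proof. by rewrite sumr_const card_ord mulr_natl. Qed.

Section Drift.
Variables (R : realType) (N Amax Smax : nat).
Variables (pA : nat -> R) (pS : 'I_N -> nat -> R) (phi : state N -> 'I_N -> R).
Hypothesis hpA : pmf_bounded pA Amax.
Hypothesis hpS : forall n, pmf_bounded (pS n) Smax.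
Hypothesis hphi : is_policy phi.

Notation outcome := (outcome N Amax Smax).

Variable alpha : R.
Hypothesis ha : 0 < alpha <= 1.

(** The factor that results from summing [coord_le_perp] over the [N] coordinates of the next
    state. *)
Let C := N%:R * (1 + alpha^-1).

Let C_ge0 : 0 <= C.
Proof.
by case/andP: ha => a0 _; rewrite /C mulr_ge0 // addr_ge0 // invr_ge0 ltW.
Qed.

Variable eta : R.
Hypothesis eta_gt0 : 0 < eta.

Let B := C * (N%:R * Smax%:R) / eta.

Definition queue_total (q : state N) : R := \sum_n (q n)%:R.

Lemma total_ge0 q : 0 <= queue_total q.
Proof. exact: sumr_ge0. Qed.

Lemma total_le_normv q : queue_total q <= N%:R * normv (to_vec R q).
Proof.
rewrite -sumr_ord_const; apply: ler_sum => i _.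
by rewrite (le_trans _ (coord_le_normv _ i)) // mxE ger0_norm.
Qed.

Definition unused (q : state N) (o : outcome) (k : 'I_N) : nat :=
  (o.2 k - (q k + (if k == o.1.2 then o.1.1 : nat else 0)))%N.

Lemma next_state_balance q (o : outcome) k :
  (next_state q o k + o.2 k =
   q k + (if k == o.1.2 then o.1.1 : nat else 0) + unused q o k)%N.
Proof. by rewrite /unused ffunE; case: ifP => _; lia. Qed.

Lemma unused_gt0 q (o : outcome) k :
  (0 < unused q o k)%N -> next_state q o k = 0%N.
Proof. by rewrite /unused ffunE; case: ifP => _; lia. Qed.

Lemma unused_le q (o : outcome) k : (unused q o k <= Smax)%N.
Proof. by rewrite /unused; have := ltn_ord (o.2 k); lia. Qed.

Lemma total_balance q (o : outcome) :
  queue_total (next_state q o) + \sum_k (o.2 k)%:R =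
  queue_total q + (o.1.1)%:R + \sum_k (unused q o k)%:R.
Proof.
have -> : (o.1.1)%:R = \sum_k (if k == o.1.2 then o.1.1 : nat else 0)%:R :> R.
  by rewrite (bigD1 o.1.2) //= eqxx big1 ?addr0 // => k /negbTE ->.
rewrite -!big_split; apply: eq_bigr => k _ /=.
by rewrite -!natrD next_state_balance.
Qed.

Lemma total_mul_unused_le q (o : outcome) :
  queue_total (next_state q o) * \sum_k (unused q o k)%:R <=
  C * (normv (perp alpha (to_vec R (next_state q o))) * \sum_k (unused q o k)%:R).
Proof.
rewrite mulrA !mulr_sumr; apply: ler_sum => k _.
have [->|u0] := posnP (unused q o k); first by rewrite !mulr0.
rewrite ler_wpM2r // -mulrA -sumr_ord_const.
apply: ler_sum => m _.
have := @coord_le_perp _ _ alpha (to_vec R (next_state q o)) m k ha.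
by rewrite !mxE (unused_gt0 u0); apply.
Qed.

(* With [t'] the next total and [u] the total unused service,
   [t' ^ 2 = (t + a - s) ^ 2 + 2 t' u - u ^ 2]; then
   [2 |perp| u <= eta |perp| ^ 2 + u ^ 2 / eta] with [u <= N Smax], and the
   remaining linear [u] is replaced by [t' + s - t - a] with the negative terms
   moved to the left: expectations under [pi] are only additive on nonnegative
   functions. *)
Lemma sqr_total_drift q (o : outcome) :
  queue_total (next_state q o) ^+ 2 +
    (2 * queue_total q * (\sum_k (o.2 k)%:R) +
     (B * queue_total q + B * (o.1.1)%:R)) <=
  queue_total q ^+ 2 + (2 * queue_total q * (o.1.1)%:R +
    (((o.1.1)%:R - \sum_k (o.2 k)%:R) ^+ 2 +
    (C * eta * normv (perp alpha (to_vec R (next_state q o))) ^+ 2 +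
    (B * queue_total (next_state q o) + B * \sum_k (o.2 k)%:R)))).
Proof.
have := total_mul_unused_le q o.
have := total_balance q o.
have : \sum_k (unused q o k)%:R <= N%:R * Smax%:R :> R.
  rewrite -sumr_ord_const; apply: ler_sum => k _.
  by rewrite ler_nat unused_le.
have : 0 <= \sum_k (unused q o k)%:R :> R by exact: sumr_ge0.
move: (normv (perp _ _)) => p.
move: (\sum_k (unused q o k)%:R) (\sum_k (o.2 k)%:R) => u s.
move: (queue_total _) (queue_total q) => t' t.
move: ((o.1.1)%:R : R) => a u0 uK bal tu.
have -> : s = t + a + u - t' by lra.
set K : R := N%:R * Smax%:R in uK.
have amgm : 2 * (p * u) <= eta * p ^+ 2 + K * u / eta.
  have h : 0 <= (eta * p - u) ^+ 2 / eta by rewrite divr_ge0 ?sqr_ge0 ?ltW.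
  have e : (eta * p - u) ^+ 2 / eta = eta * p ^+ 2 - 2 * (p * u) + u * u / eta.
    by field; rewrite lt0r_neq0.
  have : u * u / eta <= K * u / eta.
    by rewrite ler_pM2r ?invr_gt0 // ler_wpM2r.
  by lra.
have := ler_wpM2l C_ge0 amgm.
have -> : C * (eta * p ^+ 2 + K * u / eta) = C * eta * p ^+ 2 + B * u.
  by rewrite /B -/K; ring.
(* With [s] eliminated, the goal amounts to [2 * t' * u <= u ^ 2 + C * eta * p ^ 2 + B * u]. *)
have := sqr_ge0 u; rewrite -subr_ge0 => h1 h2.
by nra.
Qed.

Let lambda := pmf_mean pA Amax.
Let mu := \sum_(n < N) pmf_mean (pS n) Smax.

(** Mean of [sqr_total_drift] over outcomes: service exceeds arrivals by [eps] on average, which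
    produces both [2 * eps] on the left and [B * eps] on the right. *)
Lemma step_exp_drift eps q : lambda = mu - eps ->
  step_exp pA pS phi q (fun o : outcome => queue_total (next_state q o) ^+ 2) +
    (2 * eps + B) * queue_total q <=
  queue_total q ^+ 2 + (pmf_var pA Amax + \sum_n pmf_var (pS n) Smax + eps ^+ 2 +
    (C * eta * step_exp pA pS phi q
       (fun o : outcome => normv (perp alpha (to_vec R (next_state q o))) ^+ 2) +
    (B * step_exp pA pS phi q (fun o : outcome => queue_total (next_state q o)) +
     B * eps))).
Proof.
move=> lmu.
have := le_step_exp hpA hpS hphi q (fun o => sqr_total_drift q o).
rewrite !step_expD (step_exp_cst hpA hpS hphi q (queue_total q ^+ 2)).
rewrite (step_exp_cst hpA hpS hphi q (B * queue_total q)) !step_expZ.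
rewrite (step_exp_sqr_net hpA hpS hphi) (step_exp_arrival_mean Amax pA hpS hphi).
rewrite (step_exp_service_mean hpA hpS hphi) -/lambda -/mu lmu.
have -> : mu - eps - mu = - eps by ring.
by rewrite sqrrN; lra.
Qed.

(** Averaging [step_exp_drift] under [pi], [Exp_step] makes the second moment of the total and [B]
    times its mean appear on both sides. Both are finite by [hmom], so they cancel and leave
    [2 * eps] times the mean. *)
Lemma heavy_traffic_bound eps pi M2 :
  0 < eps -> lambda = mu - eps ->
  stationary (trans Amax Smax pA pS phi) pi ->
  (forall r : nat, (Exp pi (fun q => (normv (to_vec R q) ^+ r)%R) < +oo)%E) ->
  (Exp pi (fun q => (normv (perp alpha (to_vec R q)) ^+ 2)%R) <= M2%:E)%E ->
  (eps%:E * Exp pi queue_total <=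
   ((pmf_var pA Amax + \sum_n pmf_var (pS n) Smax + eps ^+ 2 +
     C * eta * M2 + B * eps) / 2)%:E)%E.
Proof.
move=> eps0 lmu hst hmom hM2; have [pi0 [pi1 _]] := hst.
have B0 : 0 <= B by rewrite /B divr_ge0 ?(ltW eta_gt0) // mulr_ge0 // mulr_ge0.
have V0 : 0 <= pmf_var pA Amax + \sum_n pmf_var (pS n) Smax + eps ^+ 2.
  rewrite !addr_ge0 ?sqr_ge0 ?pmf_var_ge0 //.
  by apply: sumr_ge0 => n _; exact: pmf_var_ge0.
(* Domination by a moment of the norm gives the finiteness required for the cancellation. *)
have fin_mom r (f : state N -> R) : (forall q, 0 <= f q) ->
    (forall q, f q <= N%:R ^+ r * normv (to_vec R q) ^+ r) ->
    Exp pi f \is a fin_num.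
  move=> f0 fle; rewrite ge0_fin_numE ?Exp_ge0 //.
  apply: (le_lt_trans (le_Exp pi0 fle)); rewrite ExpZ ?exprn_ge0 //; last first.
    by move=> q; rewrite exprn_ge0 // sqrtr_ge0.
  by rewrite lte_mul_pinfty // lee_fin exprn_ge0.
have finL : Exp pi queue_total \is a fin_num.
  apply: (fin_mom 1%N) => q; first exact: total_ge0.
  by rewrite !expr1 total_le_normv.
have finS : Exp pi (fun q => queue_total q ^+ 2) \is a fin_num.
  apply: (fin_mom 2%N) => q; first exact: sqr_ge0.
  rewrite -exprMn ler_pXn2r ?nnegrE ?total_ge0 ?total_le_normv //.
  by rewrite mulr_ge0 // sqrtr_ge0.
have p0 (q : state N) : 0 <= normv (perp alpha (to_vec R q)) ^+ 2 by exact: sqr_ge0.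
have t0 q : 0 <= queue_total q by exact: total_ge0.
have t20 q : 0 <= queue_total q ^+ 2 by exact: sqr_ge0.
have e0 := ltW eps0; have et0 := ltW eta_gt0.
have finP : Exp pi (fun q => normv (perp alpha (to_vec R q)) ^+ 2) \is a fin_num.
  by rewrite ge0_fin_numE ?Exp_ge0 // (le_lt_trans hM2) // ltry.
have := le_Exp pi0 (fun q => step_exp_drift q lmu).
have B20 : 0 <= 2 * eps + B by rewrite addr_ge0 // mulr_ge0.
have Ce0 : 0 <= C * eta by rewrite mulr_ge0 // ltW.
have Be0 : 0 <= B * eps by rewrite mulr_ge0 // ltW.
have s10 q : 0 <= step_exp pA pS phi q
    (fun o : outcome => queue_total (next_state q o) ^+ 2).
  by exact: step_exp_ge0.
have s20 q : 0 <= step_exp pA pS phi q (fun o : outcome =>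
    normv (perp alpha (to_vec R (next_state q o))) ^+ 2).
  by exact: step_exp_ge0.
have s30 q : 0 <= step_exp pA pS phi q
    (fun o : outcome => queue_total (next_state q o)).
  by exact: step_exp_ge0.
(* [ExpD] asks for nonnegative summands at every level of the nested sums. *)
have w1 q : 0 <= (2 * eps + B) * queue_total q by rewrite mulr_ge0.
have w2 q : 0 <= C * eta * step_exp pA pS phi q (fun o : outcome =>
    normv (perp alpha (to_vec R (next_state q o))) ^+ 2) by rewrite mulr_ge0.
have w3 q : 0 <= B * step_exp pA pS phi q
    (fun o : outcome => queue_total (next_state q o)) by rewrite mulr_ge0.
have w4 q := addr_ge0 (w3 q) Be0.
have w5 q := addr_ge0 (w2 q) (w4 q).
have w6 q := addr_ge0 V0 (w5 q).
rewrite (ExpD pi0 s10 w1) (ExpD pi0 t20 w6) (ExpD pi0 (fun=> V0) w5).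
rewrite (ExpD pi0 w2 w4) (ExpD pi0 w3 (fun=> Be0)).
rewrite !ExpZ // !Exp_cst //.
rewrite (Exp_step hpA hpS hphi hst t20) (Exp_step hpA hpS hphi hst p0).
rewrite (Exp_step hpA hpS hphi hst t0).
move: hM2; rewrite -(fineK finL) -(fineK finS) -(fineK finP).
rewrite -!EFinM -!EFinD !lee_fin => hM2 h.
have := ler_wpM2l Ce0 hM2.
by lra.
Qed.

End Drift.

(** * Choice of the constants and passage to the limit *)

Theorem theorem1
  (R : realType) (N : nat) (hN : (0 < N)%N)
  (Amax Smax : nat)
  (* service distributions (same for every system of the family) *)
  (pS : 'I_N -> nat -> R)
  (hpS : forall n, pmf_bounded (pS n) Smax)
  (hmu : forall n, 0 < pmf_mean (pS n) Smax)
  (* arrival distributions of the family, indexed by eps in (0, eps_max) *)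
  (eps_max : R) (heps_max : 0 < eps_max)
  (pA : R -> nat -> R)
  (hpA : forall eps : R, 0 < eps < eps_max -> pmf_bounded (pA eps) Amax)
  (hpA0 : forall eps : R, 0 < eps < eps_max -> 0 < pA eps 0%N)
  (hlam : forall eps : R, 0 < eps < eps_max ->
     pmf_mean (pA eps) Amax = \sum_(n < N) pmf_mean (pS n) Smax - eps)
  (sigma2 : R)
  (hsigma : (fun eps => pmf_var (pA eps) Amax) @ 0^'+ --> (sigma2 : R))
  (* the Markovian routing policy *)
  (phi : state N -> 'I_N -> R) (hphi : is_policy phi)
  (* throughput optimality: a stationary distribution with all moments finite *)
  (pi : R -> state N -> R)
  (hstat : forall eps : R, 0 < eps < eps_max ->
     stationary (trans Amax Smax (pA eps) pS phi) (pi eps))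
  (hmom : forall eps : R, 0 < eps < eps_max -> forall r : nat,
     (Exp (pi eps) (fun q => (normv (to_vec R q) ^+ r)%R) < +oo)%E)
  (* state-space collapse onto K_alpha *)
  (alpha : R) (halpha : 0 < alpha <= 1)
  (eps0 : R) (heps0 : 0 < eps0) (M : nat -> R)
  (hssc : forall eps : R, 0 < eps < eps0 -> eps < eps_max -> forall r : nat, (0 < r)%N ->
     (Exp (pi eps) (fun q => (normv (perp alpha (to_vec R q)) ^+ r)%R) <= (M r)%:E)%E) :
  (* heavy-traffic delay optimality: limsup_{eps -> 0+} eps E[sum_n Q_n] <= zeta/2 *)
  let zeta := sigma2 + \sum_(n < N) pmf_var (pS n) Smax in
  forall delta : R, 0 < delta ->
    \forall eps \near 0^'+,
      (eps%:E * Exp (pi eps) (fun q => (\sum_(n < N) q n)%:R)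
         <= (zeta / 2 + delta)%:E)%E.
Proof.
move=> zeta delta delta0.
pose C : R := N%:R * (1 + alpha^-1).
have C0 : 0 <= C.
  by case/andP: halpha => a0 _; rewrite /C mulr_ge0 // addr_ge0 // invr_ge0 ltW.
pose D := C * `|M 2|.
have D0 : 0 <= D by rewrite mulr_ge0.
(* [eta] depends on [delta] but not on [eps], so [B] is a fixed constant before [eps] tends to 0. *)
pose eta := delta / (2 * (D + 1)).
have eta0 : 0 < eta by rewrite divr_gt0 // mulr_gt0 //; lra.
have Deta : D * eta <= delta / 2.
  rewrite /eta (_ : D * _ = delta / 2 * (D / (D + 1))); last first.
    by field; lra.
  by rewrite ler_piMr ?divr_ge0 ?(ltW delta0) // ler_pdivrMr; lra.
pose B := C * (N%:R * Smax%:R) / eta.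
have B0 : 0 <= B by rewrite /B divr_ge0 ?(ltW eta0) // mulr_ge0 // mulr_ge0.
(* Below this threshold [(B + 1) * eps <= delta / 2]; the extra 1 absorbs [eps ^+ 2], which is at
   most [eps] since [eps < 1]. *)
pose e1 := delta / (2 * (B + 1)).
have e10 : 0 < e1 by rewrite divr_gt0 // mulr_gt0 //; lra.
have near_lt (e : R) : 0 < e -> \forall eps \near (0 : R)^'+, eps < e.
  exact: nbhs_right_lt.
near=> eps.
have eps_gt0 : 0 < eps by near: eps; exact: nbhs_right_gt.
have eps_max' : eps < eps_max by near: eps; exact: near_lt.
have eps_eps0 : eps < eps0 by near: eps; exact: near_lt.
have eps_lt1 : eps < 1 by near: eps; exact: near_lt.
have eps_e1 : eps < e1 by near: eps; exact: near_lt.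
have var_lt : pmf_var (pA eps) Amax < sigma2 + delta / 2.
  near: eps; apply: (cvgr_lt sigma2) => //; lra.
have heps : 0 < eps < eps_max by rewrite eps_gt0.
have hepseps0 : 0 < eps < eps0 by rewrite eps_gt0.
have := heavy_traffic_bound (hpA _ heps) hpS hphi halpha eta0 eps_gt0
  (hlam _ heps) (hstat _ heps) (hmom _ heps) (hssc _ hepseps0 eps_max' 2 isT).
rewrite -/C -/B.
have -> : @queue_total R N = (fun q : state N => (\sum_(n < N) q n)%:R : R).
  by apply/funext => q; rewrite natr_sum.
move/le_trans; apply; rewrite lee_fin.
have M2D : C * eta * M 2 <= D * eta.
  by rewrite /D mulrAC ler_wpM2r ?(ltW eta0) // ler_wpM2l // ler_norm.
have small : eps ^+ 2 + B * eps <= delta / 2.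
  have : eps ^+ 2 <= 1 * eps by rewrite expr2 ler_wpM2r // ltW.
  have : (B + 1) * eps <= delta / 2.
    rewrite (_ : delta / 2 = (B + 1) * e1); last by rewrite /e1; field; lra.
    by rewrite ler_wpM2l ?(ltW eps_e1) //; lra.
  by lra.
(* The variance gap, the [eta] term and [small] cost at most [delta / 2] each, hence [3 * delta / 4]
   after the division by 2. *)
by rewrite /zeta; lra.
Unshelve. all: by end_near.
Qed.
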